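(* Let $\alpha\in(0,1)$. For any vector $\mathbf{g}\in\mathbb{R}^{N-1}$, the matrix-vector product $\mathbf{A}\mathbf{g}$, where $\mathbf{A}$ is the coefficient matrix of the fast collocation scheme on a general nonuniform grid with $N$ subintervals and $N_e$ exponentials in the SOE approximation, can be carried out in $\mathcal{O}(NN_e)$ operations. Moreover, the total memory requirement is also of order $\mathcal{O}(NN_e)$.
   Context: Operations are elementary real operations (including evaluation of exponentials and powers) in exact arithmetic, memory counts stored real numbers, and the $\mathcal{O}$-constants are absolute. The input consists of $\alpha$, the grid, the SOE parameters and $\mathbf{g}$; the matrix $\mathbf{A}$ is not assembled. Grid: $a=x_0<x_1<\cdots<x_N=b$, $h_j=x_j-x_{j-1}$. $\phi_j$ ($1\le j\le N-1$) is the continuous piecewise linear hat function with $\phi_j(x_k)=\delta_{jk}$, zero outside $[x_{j-1},x_{j+1}]$. The SOE parameters are positive numbers $\lambda_s,\theta_s$, $1\le s\le N_e$ (chosen so that $\sum_s\theta_se^{-\lambda_sx}$ approximates $x^{-1-\alpha}$). The matrix $\mathbf{A}=(a_{i,j})\in\mathbb{R}^{(N-1)\times(N-1)}$ for $\alpha\in(0,1)$ has entries $$a_{i,j}=\begin{cases} -\int_{x_{j-1}}^{x_{j+1}}\phi_j(y)\sum_{s=1}^{N_e}\theta_se^{-\lambda_s(y-x_i)}\,dy, & j\ge i+2,\\[2pt] -\frac{h_{i+1}^{-\alpha}}{1-\alpha}-\int_{x_{i+1}}^{x_{i+2}}\phi_{i+1}(y)\sum_{s=1}^{N_e}\theta_se^{-\lambda_s(y-x_i)}\,dy,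 & j=i+1,\\[2pt] \frac{h_i^{-\alpha}+h_{i+1}^{-\alpha}}{\alpha(1-\alpha)}, & j=i,\\[2pt] -\frac{h_i^{-\alpha}}{1-\alpha}-\int_{x_{i-2}}^{x_{i-1}}\phi_{i-1}(y)\sum_{s=1}^{N_e}\theta_se^{-\lambda_s(x_i-y)}\,dy, & j=i-1,\\[2pt] -\int_{x_{j-1}}^{x_{j+1}}\phi_j(y)\sum_{s=1}^{N_e}\theta_se^{-\lambda_s(x_i-y)}\,dy, & j\le i-2. \end{cases}$$ *)

(* Defs.v *)
From HB Require Import structures.
From mathcomp Require Import all_boot all_order all_algebra.
From mathcomp Require Import all_classical all_reals all_analysis.

Set Implicit Arguments.
Unset Strict Implicit.
Unset Printing Implicit Defensive.

Import Order.TTheory GRing.Theory Num.Theory.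
Import numFieldNormedType.Exports.

Local Open Scope ring_scope.

Section Scheme.
Context {R : realType} (N Ne : nat).
Variables (alpha : R) (x : N.+1.-tuple R) (lambda theta : Ne.-tuple R).

Definition mesh (j : nat) : R := x`_j - x`_j.-1.

Definition hat (j : nat) (y : R) : R :=
  if x`_j.-1 <= y <= x`_j then (y - x`_j.-1) / mesh j
  else if x`_j <= y <= x`_j.+1 then (x`_j.+1 - y) / mesh j.+1
  else 0.

Definition soe (z : R) : R :=
  \sum_(s < Ne) tnth theta s * expR (- tnth lambda s * z).

(* The indices i and j of coef run over 1, ..., N - 1, as on paper; the
   ordinal indices of coef_mx are shifted by one. *)
Definition coef (i j : nat) : R :=
  if (i.+2 <= j)%N then
    - (\int[lebesgue_measure]_(y in `[x`_j.-1, x`_j.+1])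
         (hat j y * soe (y - x`_i)))
  else if j == i.+1 then
    - (mesh i.+1 `^ (- alpha) / (1 - alpha))
    - \int[lebesgue_measure]_(y in `[x`_i.+1, x`_i.+2])
         (hat i.+1 y * soe (y - x`_i))
  else if j == i then
    (mesh i `^ (- alpha) + mesh i.+1 `^ (- alpha)) / (alpha * (1 - alpha))
  else if j.+1 == i then
    - (mesh i `^ (- alpha) / (1 - alpha))
    - \int[lebesgue_measure]_(y in `[x`_(i - 2), x`_i.-1])
         (hat i.-1 y * soe (x`_i - y))
  else
    - (\int[lebesgue_measure]_(y in `[x`_j.-1, x`_j.+1])
         (hat j y * soe (x`_i - y))).

Definition coef_mx : 'M[R]_N.-1 := \matrix_(i, j) coef i.+1 j.+1.

End Scheme.

(* A real random access machine, programmed with counted loops.  The real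
   memory is an array of cells addressed by natural numbers.  Control flow and
   addresses depend on the problem sizes and the loop counters only, never on
   the stored reals, and programs contain no real constants besides integers. *)

Inductive iexp : Type :=
| ILit of nat
| IVar of nat
| IAdd of iexp & iexp
| ISub of iexp & iexp.

Inductive binop : Type := Add | Sub | Mul | Div | Pow.

Inductive operation : Type :=
| Lit of int
| Bin of binop & iexp & iexp
| Exp of iexp.

Inductive program : Type :=
| Store of iexp & operation
| Seq of program & program
| For of nat & iexp & program.

Definition ienv : Type := nat -> nat.

Fixpoint iexp_val (env : ienv) (e : iexp) : nat :=
  match e with
  | ILit n => n
  | IVar v => env v
  | IAdd e1 e2 => (iexp_val env e1 + iexp_val env e2)%N
  | ISub e1 e2 => (iexp_val env e1 - iexp_val env e2)%N
  end.

Section Semantics.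
Context {R : realType}.

Definition memory : Type := nat -> R.

(* None: the operation is undefined (division by zero, or power of a
   nonpositive base). *)
Definition binop_val (o : binop) (u v : R) : option R :=
  match o with
  | Add => Some (u + v)
  | Sub => Some (u - v)
  | Mul => Some (u * v)
  | Div => if v == 0 then None else Some (u / v)
  | Pow => if 0 < u then Some (u `^ v) else None
  end.

Definition operation_val (env : ienv) (m : memory) (o : operation) :
    option R :=
  match o with
  | Lit z => Some z%:~R
  | Bin b e1 e2 => binop_val b (m (iexp_val env e1)) (m (iexp_val env e2))
  | Exp e => Some (expR (m (iexp_val env e)))
  end.

(* For v e p runs p for v = 0, ..., n - 1, where n is the value of e. *)
Fixpoint run (p : program) (env : ienv) (m : memory) : option memory :=
  match p with
  | Store e o =>
      omap (fun u : R => [eta m with iexp_val env e |-> u] : memory)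
        (operation_val env m o)
  | Seq p1 p2 => obind (run p2 env) (run p1 env m)
  | For v e q =>
      foldl (fun om i => obind (run q [eta env with v |-> i]) om)
        (Some m) (iota 0 (iexp_val env e))
  end.

End Semantics.

(* Number of real operations executed by a run; constant loads count too. *)
Fixpoint op_count (p : program) (env : ienv) : nat :=
  match p with
  | Store _ _ => 1
  | Seq p1 p2 => op_count p1 env + op_count p2 env
  | For v e q =>
      \sum_(i < iexp_val env e) op_count q [eta env with v |-> val i]
  end.

Definition operation_cells (env : ienv) (o : operation) : nat :=
  match o with
  | Lit _ => 0
  | Bin _ e1 e2 => maxn (iexp_val env e1).+1 (iexp_val env e2).+1
  | Exp e => (iexp_val env e).+1
  end.

(* Length of the initial segment of the memory that a run reads or writes. *)
Fixpoint cell_count (p : program) (env : ienv) : nat :=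
  match p with
  | Store e o => maxn (iexp_val env e).+1 (operation_cells env o)
  | Seq p1 p2 => maxn (cell_count p1 env) (cell_count p2 env)
  | For v e q =>
      \max_(i < iexp_val env e) cell_count q [eta env with v |-> val i]
  end.

(* Variable 0 initially holds N and variable 1 holds Ne. *)
Definition size_env (N Ne : nat) : ienv := nth 0%N [:: N; Ne].

Definition input (R : realType) (N Ne : nat) (alpha : R) (x : N.+1.-tuple R)
    (lambda theta : Ne.-tuple R) (g : 'cV[R]_N.-1) : seq R :=
  alpha :: x ++ lambda ++ theta ++ [seq g i 0 | i <- enum 'I_N.-1].

Definition input_size (N Ne : nat) : nat := (1 + N.+1 + Ne + Ne + N.-1)%N.

Lemma size_input (R : realType) (N Ne : nat) (alpha : R) (x : N.+1.-tuple R)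
    (lambda theta : Ne.-tuple R) (g : 'cV[R]_N.-1) :
  size (input alpha x lambda theta g) = input_size N Ne.
Proof.
by rewrite /input /input_size /= !size_cat !size_tuple card_ord
  !addnA.
Qed.

(* p started on the input (all further cells being 0) succeeds and leaves the
   vector v in the N - 1 cells that follow those of the input. *)
Definition outputs (R : realType) (N Ne : nat) (p : program) (inp : seq R)
    (v : 'cV[R]_N.-1) : Prop :=
  exists2 m : memory, run p (size_env N Ne) (nth 0 inp) = Some m
    & forall i : 'I_N.-1, m (input_size N Ne + i)%N = v i 0.

(* Cells of the input and of the output are counted even if not accessed. *)
Definition memory_count (N Ne : nat) (p : program) : nat :=
  maxn (input_size N Ne + N.-1) (cell_count p (size_env N Ne)).

(* Main.v *)
Require Import Defs.
From HB Require Import structures.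
From mathcomp Require Import all_boot all_order all_algebra.
From mathcomp Require Import all_classical all_reals all_analysis.
From mathcomp Require Import ring zify.

Set Implicit Arguments.
Unset Strict Implicit.
Unset Printing Implicit Defensive.

Import Order.TTheory GRing.Theory Num.Theory.
Import numFieldNormedType.Exports.

Local Open Scope ring_scope.

(** Count rows and columns from 1 to N - 1 and let h_k = x_k - x_(k-1).  The
    matrix is tridiagonal plus a sum over the Ne exponentials, and each
    exponential contributes a semiseparable part: away from the diagonal its
    entry (i, j) is the integral of hat j against e^(- lambda |y - x_i|), which
    depends on i only through a factor e^(- lambda x_i) for j < i and
    e^(lambda x_i) for j > i.  Hence the part T_i of the row sum coming from the
    columns j < i obeys a two term recurrence along the grid.  Adding to T_i the
    half of hat i - 1 lying on the interval [x_(i-1), x_i], which T_i omits but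
    all later rows contain, gives the accumulator U_i, and

      T_(i+1) = e^(- lambda h_(i+1)) (U_i + P_i g_i),
      U_(i+1) = T_(i+1) + Q_(i+1) g_i,

    where P_k and Q_k are the integrals over an interval of length h_k of a
    half hat against the exponential, according to whether the half hat peaks
    at the end nearer to the point of evaluation or at the other one
    ([near_peak], [far_peak]).  The columns j > i are treated by the same
    recurrence run backwards.  For each exponential the two sweeps take O(1)
    operations per grid point and one accumulator cell, and the tridiagonal
    part takes O(N) operations, so that the total is O(N Ne) operations and
    O(N + Ne) cells.

    There are three ingredients.  The fundamental theorem of calculus gives
    P_k, Q_k and the entries of the matrix in closed form ([integral_hat_soe]
    and its variants, [coefE]).  A compiler from arithmetic expressions to the
    machine, together with Hoare triples that also bound operations and cells
    ([run_compile], [triple_assign], [triple_for]), reduces a run of the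
    program to equations between reals.  Finally, the accumulator is given its
    closed form as a sum of full hat integrals ([left_acc], [right_acc]), which
    serves as loop invariant and makes the comparison with the rows of the
    matrix a splitting of sums ([matvecE]). *)

(** * Integrals of exponential sums against hat functions *)

Lemma Rintegral_antiderivative (R : realType) (f F : R -> R) (a b : R) :
  a < b -> continuous f -> (forall y : R, is_derive y 1 F (f y)) ->
  \int[lebesgue_measure]_(y in `[a, b]) f y = F b - F a.
Proof.
move=> ab cf dF.
have cF : continuous F.
  by move=> y; apply: differentiable_continuous; apply/derivable1_diffP.
rewrite /Rintegral (@continuous_FTC2 _ _ F) //.
- exact: continuous_subspaceT.
- split=> [y _||]; first exact: ex_derive.
  + exact/cvg_at_right_filter/cF.
  + exact/cvg_at_left_filter/cF.
- by move=> y _; rewrite derive1E; exact: derive_val.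
Qed.

(** A hat function agrees with a smooth function on each half of its support
    only.  As both closed halves contain the midpoint, the glued integrand is
    continuous, hence integrable, on the whole interval. *)
Lemma Rintegral_glue (R : realType) (f f1 f2 : R -> R) (a c b : R) :
  a <= c <= b -> continuous f1 -> continuous f2 ->
  {in `[a, c], f =1 f1} -> {in `[c, b], f =1 f2} ->
  \int[lebesgue_measure]_(y in `[a, b]) f y =
  \int[lebesgue_measure]_(y in `[a, c]) f1 y +
  \int[lebesgue_measure]_(y in `[c, b]) f2 y.
Proof.
move=> /andP[ac cb] cf1 cf2 ff1 ff2.
have wf : ({within `[a, b], continuous f})%classic.
  have -> : (`[a, b] = `[a, c] `|` `[c, b])%classic.
    apply/seteqP; split=> y /=; rewrite !in_itv /=.
      by case/andP=> -> ->; case: (leP y c) => [|/ltW ->]; [left|right].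
    by case=> /andP[h1 h2]; rewrite ?(le_trans ac h1) ?(le_trans h2 cb) ?h1 ?h2.
  apply: withinU_continuous; try exact: itv_closed.
    apply: (@subspace_eq_continuous _ _ _ f1); last exact: continuous_subspaceT.
    by move=> y /set_mem; rewrite /from_subspace /= => /ff1.
  apply: (@subspace_eq_continuous _ _ _ f2); last exact: continuous_subspaceT.
  by move=> y /set_mem; rewrite /from_subspace /= => /ff2.
have fint : lebesgue_measure.-integrable `[a, b] (EFin \o f).
  by apply: continuous_compact_integrable => //; exact: segment_compact.
have := Rintegral_itvB fint (x := c); rewrite !bnd_simp => /(_ ac cb).
rewrite Rintegral_itv_obnd_cbnd => [/(canRL (subrK _)) ->|]; last first.
  by apply: integrableS fint => //; apply: subset_itvr; rewrite bnd_simp.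
by rewrite addrC; congr (_ + _); apply: eq_Rintegral => y /set_mem; auto.
Qed.

Lemma is_derive_affine (R : realType) (p q y : R) :
  is_derive y 1 (fun z => p * z + q) p.
Proof.
have := is_deriveD (is_deriveZ p (is_derive_id y (1 : R)))
  (is_derive_cst q y 1).
by rewrite addr0 [_ *: _]mulr1.
Qed.

Section Kernel.
Context {R : realType} (n : nat) (w mu : 'I_n -> R).

Lemma is_derive_expR_affine (p c y : R) :
  is_derive y 1 (fun z => expR (p * (z - c))) (p * expR (p * (y - c))).
Proof.
have dL : is_derive y 1 (fun z => p * (z - c)) p.
  under eq_fun do rewrite mulrBr; exact: is_derive_affine.
by rewrite mulrC; apply: is_derive1_comp.
Qed.

Lemma continuous_linear_expsum (p q c : R) :
  continuous (fun y => (p * y + q) * \sum_(s < n) w s * expR (mu s * (y - c))).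
Proof.
pose E s (z : R) := w s * expR (mu s * (z - c)).
have dE s (y : R) : is_derive y 1 (E s) (w s * (mu s * expR (mu s * (y - c)))).
  exact: (is_deriveZ (w s) (is_derive_expR_affine (mu s) c y)).
have dS (y : R) := is_derive_sum (fun s : 'I_n => dE s y).
have dP (y : R) := is_deriveM (is_derive_affine p q y) (dS y).
move=> y; have [+ _] := dP y.
rewrite fct_sumE => /derivable1_diffP /differentiable_continuous.
exact.
Qed.

(** The antiderivative of (p y + q) e^(mu (y - c)) is
    e^(mu (y - c)) ((p y + q) / mu - p / mu^2). *)
Lemma Rintegral_linear_expsum (p q c a b : R) :
  a < b -> (forall s, mu s != 0) ->
  \int[lebesgue_measure]_(y in `[a, b])
     ((p * y + q) * \sum_(s < n) w s * expR (mu s * (y - c))) =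
  \sum_(s < n) w s *
    (expR (mu s * (b - c)) * ((p * b + q) / mu s - p / mu s ^+ 2) -
     expR (mu s * (a - c)) * ((p * a + q) / mu s - p / mu s ^+ 2)).
Proof.
move=> ab mu0.
pose G s (y : R) : R :=
  w s * (expR (mu s * (y - c)) * (p / mu s * y + (q / mu s - p / mu s ^+ 2))).
have dG s (y : R) : is_derive y 1 (G s)
   ((p * y + q) * (w s * expR (mu s * (y - c)))).
  have dP := is_deriveM (is_derive_expR_affine (mu s) c y)
    (is_derive_affine (p / mu s) (q / mu s - p / mu s ^+ 2) y).
  have dwP := is_deriveZ (w s) dP.
  apply: (@is_derive_eq _ _ _ _ _ _ _ _ dwP).
  rewrite /GRing.scale /=.
  by field; exact: mu0.
have dS (y : R) : is_derive y 1 (\sum_(s < n) G s)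
     ((p * y + q) * \sum_(s < n) w s * expR (mu s * (y - c))).
  rewrite mulr_sumr; exact: is_derive_sum.
rewrite (Rintegral_antiderivative ab _ dS) //; last first.
  exact: continuous_linear_expsum.
rewrite !fct_sumE -sumrB; apply: eq_bigr => s _.
by rewrite /G; field; exact: mu0.
Qed.
End Kernel.

Section HalfHats.
Context {R : realType}.

(** The integral of (1 - t / h) e^(- l t) for t in [0, h]: a half hat that
    peaks at the end from which the exponential decays. *)
Definition near_peak (l h : R) : R :=
  (l * h - 1 + expR (- (l * h))) / (l * (l * h)).

(** The integral of (t / h) e^(- l t) for t in [0, h]: a half hat that peaks
    at the end opposite to the one from which the exponential decays. *)
Definition far_peak (l h : R) : R :=
  (1 - expR (- (l * h)) * (1 + l * h)) / (l * (l * h)).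

Context (Ne : nat) (lambda theta : Ne.-tuple R).
Hypothesis lambda_gt0 : forall s, 0 < tnth lambda s.

Let lambda_neq0 s : tnth lambda s != 0.
Proof. by rewrite gt_eqF. Qed.

Lemma continuous_linear_soe (p q c : R) :
  continuous (fun y => (p * y + q) * soe lambda theta (y - c)).
Proof. exact: continuous_linear_expsum. Qed.

Lemma continuous_linear_soeN (p q c : R) :
  continuous (fun y => (p * y + q) * soe lambda theta (c - y)).
Proof.
rewrite [X in continuous X](_ : _ = fun y => (p * y + q) *
  \sum_(s < Ne) tnth theta s * expR (tnth lambda s * (y - c))).
  exact: continuous_linear_expsum.
apply/funext => y; congr (_ * _); apply: eq_bigr => s _.
by rewrite mulNr -mulrN opprB.
Qed.

(** A linear function on [a, b] combines the two half hats of that interval with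
    its values at the ends as weights.  The exponentials decay from a to b, so
    the half hat that peaks at a is the near one. *)
Lemma Rintegral_linear_soe (p q c a b : R) : a < b ->
  \int[lebesgue_measure]_(y in `[a, b])
     ((p * y + q) * soe lambda theta (y - c)) =
  \sum_(s < Ne) tnth theta s * (expR (- tnth lambda s * (a - c)) *
    ((p * a + q) * near_peak (tnth lambda s) (b - a)
     + (p * b + q) * far_peak (tnth lambda s) (b - a))).
Proof.
move=> ab; have ba : b - a != 0 by rewrite gt_eqF// subr_gt0.
rewrite (@Rintegral_linear_expsum _ _ _ (fun s => - tnth lambda s))//;
  last first.
  by move=> s; rewrite oppr_eq0.
apply: eq_bigr => s _; congr (_ * _); rewrite /near_peak /far_peak.
have -> : - tnth lambda s * (b - c) =
    - tnth lambda s * (a - c) + - (tnth lambda s * (b - a)) by ring.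
by rewrite expRD; field; rewrite ba lambda_neq0.
Qed.

(** The mirror image: now the exponentials decay from b to a, and the two half
    hats exchange their roles. *)
Lemma Rintegral_linear_soeN (p q c a b : R) : a < b ->
  \int[lebesgue_measure]_(y in `[a, b])
     ((p * y + q) * soe lambda theta (c - y)) =
  \sum_(s < Ne) tnth theta s * (expR (- tnth lambda s * (c - b)) *
    ((p * b + q) * near_peak (tnth lambda s) (b - a)
     + (p * a + q) * far_peak (tnth lambda s) (b - a))).
Proof.
move=> ab; have ba : b - a != 0 by rewrite gt_eqF// subr_gt0.
transitivity (\int[lebesgue_measure]_(y in `[a, b])
  ((p * y + q) *
   \sum_(s < Ne) tnth theta s * expR (tnth lambda s * (y - c)))).
  apply: eq_Rintegral => y _; congr (_ * _); apply: eq_bigr => s _.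
  by rewrite mulNr -mulrN opprB.
rewrite Rintegral_linear_expsum//.
apply: eq_bigr => s _; congr (_ * _); rewrite /near_peak /far_peak.
have -> : tnth lambda s * (b - c) = - tnth lambda s * (c - b) by ring.
have -> : tnth lambda s * (a - c) =
    - tnth lambda s * (c - b) + - (tnth lambda s * (b - a)) by ring.
by rewrite expRD; field; rewrite ba lambda_neq0.
Qed.

Context (N : nat) (x : N.+1.-tuple R).
Hypothesis x_lt : forall k, (k < N)%N -> x`_k < x`_k.+1.

Lemma hat_rising k y : (k < N)%N -> y \in `[x`_k, x`_k.+1] ->
  hat x k.+1 y = (mesh x k.+1)^-1 * y - x`_k / mesh x k.+1.
Proof. by move=> kN; rewrite in_itv /hat /= => ->; rewrite mulrBl mulrC. Qed.

Lemma hat_falling k y : (k.+1 < N)%N -> y \in `[x`_k.+1, x`_k.+2] ->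
  hat x k.+1 y = - (mesh x k.+2)^-1 * y + x`_k.+2 / mesh x k.+2.
Proof.
move=> kN; rewrite in_itv /hat /= => yI; rewrite yI.
have /x_lt k0 := ltnW kN; have k1 := x_lt kN.
have h1 : mesh x k.+1 != 0 by rewrite gt_eqF// subr_gt0.
have h2 : mesh x k.+2 != 0 by rewrite gt_eqF// subr_gt0.
case: ifP => [/andP[_ yle]|_]; last by rewrite mulrBl mulrC; ring.
have -> : y = x`_k.+1 by apply/eqP; rewrite eq_le yle; case/andP: yI.
rewrite -/(mesh x k.+1) mulfV //.
by rewrite mulNr [_^-1 * _]mulrC addrC -mulrBl; exact/esym/mulfV.
Qed.

Lemma integral_falling_soe k (c : R) : (k.+1 < N)%N ->
  \int[lebesgue_measure]_(y in `[x`_k.+1, x`_k.+2])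
     (hat x k.+1 y * soe lambda theta (y - c)) =
  \sum_(s < Ne) tnth theta s * (expR (- tnth lambda s * (x`_k.+1 - c)) *
    near_peak (tnth lambda s) (mesh x k.+2)).
Proof.
move=> kN; have k1 := x_lt kN.
have h2 : mesh x k.+2 != 0 by rewrite gt_eqF// subr_gt0.
under eq_Rintegral => y /set_mem yI do rewrite (hat_falling kN yI).
rewrite Rintegral_linear_soe //; apply: eq_bigr => s _; congr (_ * (_ * _)).
rewrite -/(mesh x k.+2) ; move: h2; rewrite /mesh /= => h2.
by field.
Qed.

Lemma integral_rising_soeN k (c : R) : (k < N)%N ->
  \int[lebesgue_measure]_(y in `[x`_k, x`_k.+1])
     (hat x k.+1 y * soe lambda theta (c - y)) =
  \sum_(s < Ne) tnth theta s * (expR (- tnth lambda s * (c - x`_k.+1)) *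
    near_peak (tnth lambda s) (mesh x k.+1)).
Proof.
move=> kN; have k1 := x_lt kN.
have h2 : mesh x k.+1 != 0 by rewrite gt_eqF// subr_gt0.
under eq_Rintegral => y /set_mem yI do rewrite (hat_rising kN yI).
rewrite Rintegral_linear_soeN //; apply: eq_bigr => s _; congr (_ * (_ * _)).
move: h2; rewrite /mesh /= => h2.
by field.
Qed.

Lemma integral_hat_soe k (c : R) : (k.+1 < N)%N ->
  \int[lebesgue_measure]_(y in `[x`_k, x`_k.+2])
     (hat x k.+1 y * soe lambda theta (y - c)) =
  \sum_(s < Ne) tnth theta s *
    (expR (- tnth lambda s * (x`_k - c)) * far_peak (tnth lambda s) (mesh x k.+1)
     + expR (- tnth lambda s * (x`_k.+1 - c))
       * near_peak (tnth lambda s) (mesh x k.+2)).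
Proof.
move=> kN; have k1 := x_lt kN; have /x_lt k0 := ltnW kN.
have h1 : mesh x k.+1 != 0 by rewrite gt_eqF// subr_gt0.
have h2 : mesh x k.+2 != 0 by rewrite gt_eqF// subr_gt0.
rewrite (@Rintegral_glue _ _
  (fun y => ((mesh x k.+1)^-1 * y + - (x`_k / mesh x k.+1))
     * soe lambda theta (y - c))
  (fun y => (- (mesh x k.+2)^-1 * y + x`_k.+2 / mesh x k.+2)
     * soe lambda theta (y - c)) _ x`_k.+1).
- rewrite !Rintegral_linear_soe // -big_split /=; apply: eq_bigr => s _.
  rewrite -mulrDr; congr (_ * (_ * _ + _ * _)).
    by move: h1; rewrite /mesh /= => h1; field.
  by move: h2; rewrite /mesh /= => h2; field.
- by rewrite !ltW.
- exact: continuous_linear_soe.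
- exact: continuous_linear_soe.
- by move=> y yI; rewrite hat_rising // ltnW.
- by move=> y yI; rewrite hat_falling.
Qed.

Lemma integral_hat_soeN k (c : R) : (k.+1 < N)%N ->
  \int[lebesgue_measure]_(y in `[x`_k, x`_k.+2])
     (hat x k.+1 y * soe lambda theta (c - y)) =
  \sum_(s < Ne) tnth theta s *
    (expR (- tnth lambda s * (c - x`_k.+1)) * near_peak (tnth lambda s) (mesh x k.+1)
     + expR (- tnth lambda s * (c - x`_k.+2))
       * far_peak (tnth lambda s) (mesh x k.+2)).
Proof.
move=> kN; have k1 := x_lt kN; have /x_lt k0 := ltnW kN.
have h1 : mesh x k.+1 != 0 by rewrite gt_eqF// subr_gt0.
have h2 : mesh x k.+2 != 0 by rewrite gt_eqF// subr_gt0.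
rewrite (@Rintegral_glue _ _
  (fun y => ((mesh x k.+1)^-1 * y + - (x`_k / mesh x k.+1))
     * soe lambda theta (c - y))
  (fun y => (- (mesh x k.+2)^-1 * y + x`_k.+2 / mesh x k.+2)
     * soe lambda theta (c - y)) _ x`_k.+1).
- rewrite !Rintegral_linear_soeN // -big_split /=; apply: eq_bigr => s _.
  rewrite -mulrDr; congr (_ * (_ * _ + _ * _)).
    by move: h1; rewrite /mesh /= => h1; field.
  by move: h2; rewrite /mesh /= => h2; field.
- by rewrite !ltW.
- exact: continuous_linear_soeN.
- exact: continuous_linear_soeN.
- by move=> y yI; rewrite hat_rising // ltnW.
- by move=> y yI; rewrite hat_falling.
Qed.

End HalfHats.

(** * Hoare triples with resource bounds *)

Section Triples.
Context {R : realType}.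
Implicit Types (P Q : @memory R -> Prop) (p q : program) (env : ienv).

(** Operations are additive along a run while cells are reused, so that c is
    added up by the rules below and b is fixed once and for all.  Bounding both
    in the triple lets one analysis of a loop body serve for its effect and its
    cost. *)
Definition triple (b c : nat) env P p Q : Prop :=
  [/\ (op_count p env <= c)%N, (cell_count p env <= b)%N
    & forall m, P m -> exists2 m', run p env m = Some m' & Q m'].

Lemma triple_seq b c1 c2 env P P' Q p q :
  triple b c1 env P p P' -> triple b c2 env P' q Q ->
  triple b (c1 + c2) env P (Seq p q) Q.
Proof.
move=> [p1 p2 p3] [q1 q2 q3]; split=> /=; first exact: leq_add.
  by rewrite geq_max p2.
by move=> m /p3[m' -> /q3]; exact.
Qed.

Lemma triple_for b c env (P : nat -> memory -> Prop) v e q :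
  (forall i, (i < iexp_val env e)%N ->
     triple b c [eta env with v |-> i] (P i) q (P i.+1)) ->
  triple b (iexp_val env e * c) env (P 0%N) (For v e q) (P (iexp_val env e)).
Proof.
move=> h; split=> /=.
- rewrite -[X in (_ <= X * c)%N]card_ord -sum_nat_const.
  by apply: leq_sum => i _; have [] := h _ (ltn_ord i).
- by apply/bigmax_leqP => i _; have [] := h _ (ltn_ord i).
- move=> m Pm; set n := iexp_val env e in h *.
  have: (n <= n)%N by [].
  elim: {1 3 4}n => [_|k IHk kn]; first by exists m.
  have [m1 run1 /(let: And3 _ _ t := h k kn in t)[m2 run2 P2]] := IHk (ltnW kn).
  by exists m2; rewrite // -addn1 iotaD foldl_cat run1.
Qed.

End Triples.

(** * Compiling arithmetic expressions *)

Inductive expr : Type :=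
| Cell of iexp
| Const of int
| Op of binop & expr & expr
| Expn of expr.

Fixpoint depth (e : expr) : nat :=
  match e with
  | Cell _ | Const _ => 1
  | Op _ e1 e2 => maxn (depth e1) (depth e2).+1
  | Expn e1 => depth e1
  end.

Fixpoint cost (e : expr) : nat :=
  match e with
  | Cell _ => 2
  | Const _ => 1
  | Op _ e1 e2 => cost e1 + cost e2 + 1
  | Expn e1 => cost e1 + 1
  end.

Fixpoint below (T : nat) (env : ienv) (e : expr) : bool :=
  match e with
  | Cell a => (iexp_val env a < T)%N
  | Const _ => true
  | Op _ e1 e2 => below T env e1 && below T env e2
  | Expn e1 => below T env e1
  end.

(** Stack evaluation: the value of e goes to cell tmp + d, and only cells from
    tmp + d upwards are written.  The machine has no copy instruction, so a cell
    is read by adding it to a zero that is first put at the destination. *)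
Fixpoint compile (tmp : iexp) (d : nat) (e : expr) : program :=
  let cell := IAdd tmp (ILit d) in
  match e with
  | Cell a => Seq (Store cell (Lit 0)) (Store cell (Bin Add a cell))
  | Const z => Store cell (Lit z)
  | Op o e1 e2 =>
      Seq (compile tmp d e1) (Seq (compile tmp d.+1 e2)
        (Store cell (Bin o cell (IAdd tmp (ILit d.+1)))))
  | Expn e1 => Seq (compile tmp d e1) (Store cell (Exp cell))
  end.

Definition assign (tmp a : iexp) (e : expr) : program :=
  Seq (compile tmp 0 e) (Seq (Store (IAdd tmp (ILit 1)) (Lit 0))
    (Store a (Bin Add (IAdd tmp (ILit 0)) (IAdd tmp (ILit 1))))).

Section Compiler.
Context {R : realType}.
Implicit Types (m : @memory R) (env : ienv) (e : expr).

Fixpoint eval env m e : option R :=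
  match e with
  | Cell a => Some (m (iexp_val env a))
  | Const z => Some z%:~R
  | Op o e1 e2 =>
      obind (fun u => obind (binop_val o u) (eval env m e2)) (eval env m e1)
  | Expn e1 => omap expR (eval env m e1)
  end.

Lemma eval_below T env m m' e : below T env e ->
  (forall k, (k < T)%N -> m k = m' k) -> eval env m e = eval env m' e.
Proof.
move=> + mm'; elim: e => //= [a aT|op e1 IH1 e2 IH2|e1 IH1].
- by rewrite mm'.
- by case/andP=> /IH1 -> /IH2 ->.
- by move/IH1 ->.
Qed.

Lemma op_count_compile env tmp d e :
  op_count (compile tmp d e) env = cost e.
Proof.
by elim: e d => //= [op e1 IH1 e2 IH2|e1 IH1] d; rewrite IH1 ?IH2 ?addnA.
Qed.

Lemma depth_gt0 e : (0 < depth e)%N.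
Proof. by elim: e => //= *; lia. Qed.

Lemma cell_count_compile T env tmp d e :
  iexp_val env tmp = T -> below T env e ->
  (cell_count (compile tmp d e) env <= T + d + depth e)%N.
Proof.
move=> tmpT; elim: e d => [a|z|op e1 IH1 e2 IH2|e1 IH1] d /=; rewrite ?tmpT.
- lia.
- lia.
- by have ? := depth_gt0 e2; case/andP=> /(IH1 d) ? /(IH2 d.+1) ?; lia.
- by have ? := depth_gt0 e1; move=> /(IH1 d) ?; lia.
Qed.

(** As e reads below T only and the temporaries start at T, evaluating the
    second operand disturbs neither the cells it reads nor the value of the
    first operand, which lies below T + d.+1. *)
Lemma run_compile T env tmp d e m v :
  iexp_val env tmp = T -> below T env e -> eval env m e = Some v ->
  exists m', [/\ run (compile tmp d e) env m = Some m', m' (T + d)%N = v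
    & forall k, (k < T + d)%N -> m' k = m k].
Proof.
move=> tmpT.
elim: e d m v => [a|z|op e1 IH1 e2 IH2|e1 IH1] d m v /=; rewrite ?tmpT.
- move=> aT [<-]; eexists; split; [by []| |].
    by rewrite /= !eqxx ltn_eqF ?addr0 // ltn_addr.
  by move=> k kT /=; rewrite ltn_eqF.
- move=> _ [<-]; eexists; split; [by []| |].
    by rewrite /= !eqxx.
  by move=> k kT /=; rewrite ltn_eqF.
- case/andP=> b1 b2; case E1: (eval env m e1) => [u1|] //=.
  case E2: (eval env m e2) => [u2|] //= ov.
  have [m1 [-> m1d m1k]] := IH1 d _ _ b1 E1.
  have E2' : eval env m1 e2 = Some u2.
    rewrite -E2; apply: (@eval_below T) => // k kT; apply: m1k.
    exact: ltn_addr.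
  have [m2 [/= -> m2d m2k]] := IH2 d.+1 _ _ b2 E2'.
  rewrite /= ?tmpT m2d m2k ?addnS // m1d ov /=.
  eexists; split; [by []|by rewrite /= eqxx|].
  move=> k kT /=; rewrite ltn_eqF // m2k ?m1k //; lia.
- move=> b1; case E1: (eval env m e1) => [u1|] //= [<-].
  have [m1 [-> m1d m1k]] := IH1 d _ _ b1 E1.
  rewrite /= ?tmpT m1d /=.
  eexists; split; [by []|by rewrite /= eqxx|].
  by move=> k kT /=; rewrite ltn_eqF // m1k.
Qed.

(** Postconditions may look below T only; what the temporaries contain
    afterwards is left open. *)
Lemma triple_assign T b env (P Q : memory -> Prop) tmp a e :
  iexp_val env tmp = T -> (iexp_val env a < T)%N -> below T env e ->
  (T + (depth e).+1 <= b)%N ->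
  (forall m, P m -> exists2 v, eval env m e = Some v &
     forall m', (forall k, (k < T)%N ->
         m' k = if k == iexp_val env a then v else m k) -> Q m') ->
  triple b (cost e + 2) env P (assign tmp a e) Q.
Proof.
move=> tmpT aT eT Tb PQ; split=> /=.
- by rewrite op_count_compile.
- have := cell_count_compile 0 tmpT eT; have := depth_gt0 e; rewrite tmpT; lia.
- move=> m /PQ[v ev Qm].
  have [m1 [-> m1d m1k]] := run_compile 0 tmpT eT ev.
  rewrite /= ?tmpT; eexists; first by [].
  apply: Qm => k kT /=; case: eqP => _.
    by rewrite eqxx ifF ?addr0; [rewrite -m1d | lia].
  rewrite ifF; first by rewrite m1k ?addn0.
  by lia.
Qed.

End Compiler.

(** * The matrix-vector program *)

(** The memory is laid out as alpha, x, lambda, theta, g, the output, one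
    accumulator cell and then the temporaries.  Integer variables 0 and 1 are
    N and Ne, variable 2 runs over the exponentials and variable 3 over the
    grid.  Grid positions count from 0: row i stands for the node x_(i+1), and mesh
    expression k for the interval from x_k to x_(k+1). *)
Definition alpha_cell : expr := Cell (ILit 0).
Definition x_cell (k : iexp) : expr := Cell (IAdd (ILit 1) k).
Definition lambda_cell (s : iexp) : expr :=
  Cell (IAdd (IAdd (ILit 2) (IVar 0)) s).
Definition theta_cell (s : iexp) : expr :=
  Cell (IAdd (IAdd (ILit 2) (IAdd (IVar 0) (IVar 1))) s).
Definition g_cell (i : iexp) : expr :=
  Cell (IAdd (IAdd (ILit 2) (IAdd (IVar 0) (IAdd (IVar 1) (IVar 1)))) i).
Definition out_addr (i : iexp) : iexp :=
  IAdd (IAdd (ILit 2) (IAdd (IVar 0) (IAdd (IVar 1)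
    (IAdd (IVar 1) (ISub (IVar 0) (ILit 1)))))) i.
Definition acc_addr : iexp := out_addr (ISub (IVar 0) (ILit 1)).
Definition tmp_addr : iexp := IAdd acc_addr (ILit 1).

Definition succ_addr (k : iexp) : iexp := IAdd k (ILit 1).

Definition neg (e : expr) : expr := Op Defs.Sub (Const 0) e.
Definition mesh_expr (k : iexp) : expr :=
  Op Defs.Sub (x_cell (succ_addr k)) (x_cell k).
Definition scaled_expr (s k : iexp) : expr :=
  Op Mul (lambda_cell s) (mesh_expr k).
Definition decay_expr (s k : iexp) : expr := Expn (neg (scaled_expr s k)).
Definition near_expr (s k : iexp) : expr :=
  Op Div
    (Op Add (Op Defs.Sub (scaled_expr s k) (Const 1)) (decay_expr s k))
    (Op Mul (lambda_cell s) (scaled_expr s k)).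
Definition far_expr (s k : iexp) : expr :=
  Op Div
    (Op Defs.Sub (Const 1)
      (Op Mul (decay_expr s k) (Op Add (Const 1) (scaled_expr s k))))
    (Op Mul (lambda_cell s) (scaled_expr s k)).
Definition power_expr (k : iexp) : expr :=
  Op Pow (mesh_expr k) (neg alpha_cell).
Definition diag_expr (k : iexp) : expr :=
  Op Div (Op Add (power_expr k) (power_expr (succ_addr k)))
    (Op Mul alpha_cell (Op Defs.Sub (Const 1) alpha_cell)).
Definition offdiag_expr (k : iexp) : expr :=
  neg (Op Div (power_expr k) (Op Defs.Sub (Const 1) alpha_cell)).

Definition set_acc (e : expr) : program := assign tmp_addr acc_addr e.
Definition add_out (i : iexp) (e : expr) : program :=
  assign tmp_addr (out_addr i) (Op Add (Cell (out_addr i)) e).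

(** One step of the recurrence: carry the accumulator, together with the near
    half of the hat at src, across the interval edge to the row dst; use it
    there; then add the far half of that hat, which lies on edge itself and so
    contributes only to the rows beyond dst. *)
Definition sweep_step (s edge near_mesh src dst : iexp) : program :=
  Seq (set_acc (Op Mul (decay_expr s edge)
        (Op Add (Cell acc_addr) (Op Mul (near_expr s near_mesh) (g_cell src)))))
  (Seq (add_out dst (neg (Op Mul (theta_cell s) (Cell acc_addr))))
       (set_acc (Op Add (Cell acc_addr)
         (Op Mul (far_expr s edge) (g_cell src))))).

Definition tridiagonal : program :=
  let t := IVar 3 in
  Seq (For 3 (ISub (IVar 0) (ILit 1))
        (add_out t (Op Mul (diag_expr t) (g_cell t))))
  (Seq (For 3 (ISub (IVar 0) (ILit 2))
        (add_out t (Op Mul (offdiag_expr (succ_addr t)) (g_cell (succ_addr t)))))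
       (For 3 (ISub (IVar 0) (ILit 2))
        (add_out (succ_addr t) (Op Mul (offdiag_expr (succ_addr t)) (g_cell t))))).

Definition forward_sweep (s : iexp) : program :=
  let t := IVar 3 in
  For 3 (ISub (IVar 0) (ILit 2)) (sweep_step s (succ_addr t) t t (succ_addr t)).

(** Loops count upwards, so the rows N - 3, ..., 0 are reached through
    r = N - (3 + t). *)
Definition backward_sweep (s : iexp) : program :=
  let r := ISub (IVar 0) (IAdd (ILit 3) (IVar 3)) in
  For 3 (ISub (IVar 0) (ILit 2))
    (sweep_step s (succ_addr r) (succ_addr (succ_addr r)) (succ_addr r) r).

Definition fast_matvec : program :=
  let s := IVar 2 in
  Seq tridiagonal
    (For 2 (IVar 1)
      (Seq (Seq (set_acc (Const 0)) (forward_sweep s))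
           (Seq (set_acc (Const 0)) (backward_sweep s)))).

(** * Running the program *)

Section FastMatvec.
Context {R : realType} (N Ne : nat) (alpha : R) (x : N.+1.-tuple R).
Context (lambda theta : Ne.-tuple R) (g : 'cV[R]_N.-1).
Hypothesis alpha01 : 0 < alpha < 1.
Hypothesis x_lt : forall k, (k < N)%N -> x`_k < x`_k.+1.
Hypothesis lambda_gt0 : forall s : 'I_Ne, 0 < tnth lambda s.

Local Notation inp := (input alpha x lambda theta g).
Local Notation isize := (input_size N Ne).
Local Notation T := (isize + N.-1 + 1)%N.
Local Notation gs := [seq g i 0 | i <- enum 'I_N.-1].

(** What is known between two assignments: the input is intact, y is the
    output so far and c is the accumulator. *)
Definition holds (y : nat -> R) (c : R) (m : memory) : Prop :=
  [/\ forall k, (k < isize)%N -> m k = nth 0 inp k,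
      forall i, (i < N.-1)%N -> m (isize + i)%N = y i
    & m (isize + N.-1)%N = c].

Definition sized (env : ienv) : Prop := env 0%N = N /\ env 1%N = Ne.

(** The value of e does not depend on the memory beyond what [holds] says, and
    in particular all operations in e are defined. *)
Definition denotes env y c (e : expr) (v : R) : Prop :=
  below T env e /\ forall m, holds y c m -> eval env m e = Some v.

Section Denotes.
Variables (env : ienv) (y : nat -> R) (c : R).
Hypothesis env_sized : sized env.
Local Notation denotes := (denotes env y c).

Lemma denotes_num z : denotes (Const z) z%:~R.
Proof. by []. Qed.

Lemma denotes_op o e1 e2 u v w : denotes e1 u -> denotes e2 v ->
  binop_val o u v = Some w -> denotes (Op o e1 e2) w.
Proof.
move=> [b1 d1] [b2 d2] ow; split=> [|m hm] /=; first exact/andP.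
by rewrite d1 //= d2.
Qed.

Lemma denotes_exp e u : denotes e u -> denotes (Expn e) (expR u).
Proof. by move=> [b1 d1]; split=> // m hm /=; rewrite d1. Qed.

Lemma denotes_neg e u : denotes e u -> denotes (neg e) (- u).
Proof.
by move=> du; apply: (denotes_op (denotes_num _) du); rewrite /= sub0r.
Qed.

Lemma denotes_acc : denotes (Cell acc_addr) c.
Proof.
have [e0 e1] := env_sized; split=> /= [|m [_ _ mc]].
  by rewrite /= e0 e1 /input_size; lia.
rewrite -mc; congr (Some (m _)); rewrite /= e0 e1 /input_size; lia.
Qed.

Lemma denotes_out i k : iexp_val env i = k -> (k < N.-1)%N ->
  denotes (Cell (out_addr i)) (y k).
Proof.
have [e0 e1] := env_sized; move=> ik kN; split=> /= [|m [_ my _]].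
  by rewrite /= e0 e1 ik /input_size; lia.
rewrite -my //; congr (Some (m _)); rewrite /= e0 e1 ik /input_size; lia.
Qed.

Lemma denotes_input a k : iexp_val env a = k -> (k < isize)%N ->
  denotes (Cell a) (nth 0 inp k).
Proof. by move=> ak kI; split=> /= [|m [mi _ _]]; rewrite ak ?mi //; lia. Qed.

Lemma denotes_alpha : denotes alpha_cell alpha.
Proof. exact: (@denotes_input _ 0%N). Qed.

Lemma denotes_x k i : iexp_val env k = i -> (i <= N)%N ->
  denotes (x_cell k) x`_i.
Proof.
move=> ki iN; have -> : x`_i = nth 0 inp (1 + i).
  by rewrite /input /= !nth_cat size_tuple ltnS iN.
by apply: denotes_input; rewrite /= ?ki // /input_size; lia.
Qed.

Lemma denotes_lambda k s : iexp_val env k = s -> (s < Ne)%N ->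
  denotes (lambda_cell k) lambda`_s.
Proof.
have [e0 e1] := env_sized.
move=> ks sNe; have -> : lambda`_s = nth 0 inp (2 + N + s).
  rewrite /input !addSn add0n /= !nth_cat !size_tuple ifF; last by lia.
  by rewrite (_ : (_ - _ = s)%N) ?sNe //; lia.
by apply: denotes_input; rewrite /= ?ks ?e0 // /input_size; lia.
Qed.

Lemma denotes_theta k s : iexp_val env k = s -> (s < Ne)%N ->
  denotes (theta_cell k) theta`_s.
Proof.
have [e0 e1] := env_sized.
move=> ks sNe; have -> : theta`_s = nth 0 inp (2 + (N + Ne) + s).
  rewrite /input !addSn add0n /= !nth_cat !size_tuple ifF; last by lia.
  rewrite ifF; last by lia.
  by rewrite (_ : (_ - _ - _ = s)%N) ?sNe //; lia.
by apply: denotes_input; rewrite /= ?ks ?e0 ?e1 // /input_size; lia.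
Qed.

Lemma denotes_g k i : iexp_val env k = i -> (i < N.-1)%N ->
  denotes (g_cell k) gs`_i.
Proof.
have [e0 e1] := env_sized.
move=> ki iN; have -> : gs`_i = nth 0 inp (2 + (N + (Ne + Ne)) + i).
  rewrite /input !addSn add0n /= !nth_cat !size_tuple ifF; last by lia.
  rewrite ifF; last by lia.
  rewrite ifF; last by lia.
  by rewrite (_ : (_ - _ - _ - _ = i)%N) //; lia.
by apply: denotes_input; rewrite /= ?ki ?e0 ?e1 // /input_size; lia.
Qed.

Lemma mesh_gt0 k : (k < N)%N -> 0 < mesh x k.+1.
Proof. by move=> /x_lt xk; rewrite subr_gt0. Qed.

Lemma lambda_nth_gt0 s : (s < Ne)%N -> 0 < lambda`_s.
Proof.
by move=> sNe; have := lambda_gt0 (Ordinal sNe); rewrite (tnth_nth 0).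
Qed.

Lemma denotes_mesh k i : iexp_val env k = i -> (i < N)%N ->
  denotes (mesh_expr k) (mesh x i.+1).
Proof.
move=> ki iN.
have ki1 : iexp_val env (succ_addr k) = i.+1 by rewrite /= ki addn1.
exact: (denotes_op (denotes_x ki1 iN) (denotes_x ki (ltnW iN))).
Qed.

Lemma denotes_power k i : iexp_val env k = i -> (i < N)%N ->
  denotes (power_expr k) (mesh x i.+1 `^ (- alpha)).
Proof.
move=> ki iN; apply: (denotes_op (denotes_mesh ki iN) (denotes_neg denotes_alpha)).
by rewrite /= mesh_gt0.
Qed.

Lemma denotes_onem_alpha : denotes (Op Defs.Sub (Const 1) alpha_cell) (1 - alpha).
Proof. exact: (denotes_op (denotes_num 1) denotes_alpha). Qed.

Lemma denotes_diag k i : iexp_val env k = i -> (i.+1 < N)%N ->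
  denotes (diag_expr k)
    ((mesh x i.+1 `^ (- alpha) + mesh x i.+2 `^ (- alpha)) /
     (alpha * (1 - alpha))).
Proof.
move=> ki iN.
have ki1 : iexp_val env (succ_addr k) = i.+1 by rewrite /= ki addn1.
have /andP[a0 a1] := alpha01.
apply: denotes_op.
- exact: (denotes_op (denotes_power ki (ltnW iN)) (denotes_power ki1 iN)).
- exact: (denotes_op denotes_alpha denotes_onem_alpha).
- by rewrite /= ifF // gt_eqF // mulr_gt0 // subr_gt0.
Qed.

Lemma denotes_offdiag k i : iexp_val env k = i -> (i < N)%N ->
  denotes (offdiag_expr k) (- (mesh x i.+1 `^ (- alpha) / (1 - alpha))).
Proof.
move=> ki iN; have /andP[a0 a1] := alpha01.
apply/denotes_neg/(denotes_op (denotes_power ki iN) denotes_onem_alpha).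
by rewrite /= ifF // gt_eqF // subr_gt0.
Qed.

Section Exponential.
Variables (sv k : iexp) (s i : nat).
Hypotheses (svs : iexp_val env sv = s) (sNe : (s < Ne)%N).
Hypotheses (ki : iexp_val env k = i) (iN : (i < N)%N).

Lemma denotes_scaled : denotes (scaled_expr sv k) (lambda`_s * mesh x i.+1).
Proof. exact: (denotes_op (denotes_lambda svs sNe) (denotes_mesh ki iN)). Qed.

Lemma denotes_decay :
  denotes (decay_expr sv k) (expR (- (lambda`_s * mesh x i.+1))).
Proof. exact/denotes_exp/denotes_neg/denotes_scaled. Qed.

Let denominator_neq0 :
  (lambda`_s * (lambda`_s * mesh x i.+1) == 0) = false.
Proof. by rewrite gt_eqF // !mulr_gt0 ?lambda_nth_gt0 ?mesh_gt0. Qed.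

Let denotes_denominator :
  denotes (Op Mul (lambda_cell sv) (scaled_expr sv k))
    (lambda`_s * (lambda`_s * mesh x i.+1)).
Proof. exact: (denotes_op (denotes_lambda svs sNe) denotes_scaled). Qed.

Lemma denotes_near : denotes (near_expr sv k) (near_peak lambda`_s (mesh x i.+1)).
Proof.
apply: (denotes_op _ denotes_denominator); last first.
  by rewrite /= denominator_neq0.
apply: denotes_op; [|exact: denotes_decay|by []].
exact: (denotes_op denotes_scaled (denotes_num 1)).
Qed.

Lemma denotes_far : denotes (far_expr sv k) (far_peak lambda`_s (mesh x i.+1)).
Proof.
apply: (denotes_op _ denotes_denominator); last first.
  by rewrite /= denominator_neq0.
apply: denotes_op; [exact: (denotes_num 1)| |by []].
apply: denotes_op; [exact: denotes_decay| |by []].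
exact: (denotes_op (denotes_num 1) denotes_scaled).
Qed.

End Exponential.
End Denotes.

(* Twelve temporaries suffice for every expression of the program. *)
Local Notation bound := (T + 12)%N.

Lemma tmp_addr_val env : sized env -> iexp_val env tmp_addr = T.
Proof. by move=> [e0 e1]; rewrite /= e0 e1 /input_size; lia. Qed.

Lemma triple_set_acc env y c e v :
  sized env -> denotes env y c e v -> (depth e <= 11)%N ->
  triple bound (cost e + 2) env (holds y c) (set_acc e) (holds y v).
Proof.
move=> es [eT ev] de; have [e0 e1] := es.
have accv : iexp_val env acc_addr = (isize + N.-1)%N.
  by rewrite /= e0 e1 /input_size; lia.
apply: (triple_assign (tmp_addr_val es) _ eT); rewrite ?accv; [lia|lia|].
move=> m hm; exists v => [|m' m'E]; first exact: ev.
have [mi my mc] := hm; split=> [k kI|i iN|].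
- by rewrite m'E ?ifF ?mi //; lia.
- by rewrite m'E ?ifF ?my //; lia.
- by rewrite m'E ?eqxx //; lia.
Qed.

Lemma triple_add_out env y c i k e v :
  sized env -> iexp_val env i = k -> (k < N.-1)%N ->
  denotes env y c e v -> (depth e <= 10)%N ->
  triple bound (cost e + 5) env (holds y c) (add_out i e)
    (holds (fun j => y j + (if j == k then v else 0)) c).
Proof.
move=> es ik kN de dpe; have [e0 e1] := es.
have outv : iexp_val env (out_addr i) = (isize + k)%N.
  by rewrite /= e0 e1 ik /input_size; lia.
have [eT ev] := denotes_op (denotes_out y c es ik kN) de
  (erefl : binop_val Add _ _ = _).
have -> : (cost e + 5 = cost (Op Add (Cell (out_addr i)) e) + 2)%N.
  by rewrite /=; lia.
apply: (triple_assign (tmp_addr_val es) _ eT); rewrite ?outv.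
- lia.
- by rewrite /=; lia.
move=> m hm; exists (y k + v) => [|m' m'E]; first exact: ev.
have [mi my mc] := hm; split=> [j jI|j jN|].
- by rewrite m'E ?ifF ?mi //; lia.
- rewrite m'E ?eqn_add2l; last by lia.
  by case: eqP => [->//|_]; rewrite my // addr0.
- by rewrite m'E ?ifF ?mc //; lia.
Qed.

Definition advance (l : R) (edge near_mesh src : nat) (c : R) : R :=
  expR (- (l * mesh x edge.+1)) * (c + near_peak l (mesh x near_mesh.+1) * gs`_src).

Lemma triple_sweep_step env y c sv ei ni si di (s edge near_mesh src dst : nat) :
  sized env ->
  iexp_val env sv = s -> (s < Ne)%N ->
  iexp_val env ei = edge -> (edge < N)%N ->
  iexp_val env ni = near_mesh -> (near_mesh < N)%N ->
  iexp_val env si = src -> (src < N.-1)%N ->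
  iexp_val env di = dst -> (dst < N.-1)%N ->
  let c' := advance lambda`_s edge near_mesh src c in
  triple bound 110 env (holds y c) (sweep_step sv ei ni si di)
    (holds (fun j => y j + (if j == dst then - (theta`_s * c') else 0))
           (c' + far_peak lambda`_s (mesh x edge.+1) * gs`_src)).
Proof.
move=> es svs sNe eie eN nin nN sis sN did dN c'.
have dec c1 := denotes_decay y c1 es svs sNe eie eN.
have nea c1 := denotes_near y c1 es svs sNe nin nN.
have fa y1 c1 := denotes_far y1 c1 es svs sNe eie eN.
have dg y1 c1 := denotes_g y1 c1 es sis sN.
have dacc y1 c1 := denotes_acc y1 c1 es.
have d1 : denotes env y c (Op Mul (decay_expr sv ei)
    (Op Add (Cell acc_addr) (Op Mul (near_expr sv ni) (g_cell si)))) c'.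
  apply: (denotes_op (dec c)) => //; apply: (denotes_op (dacc y c)) => //.
  exact: (denotes_op (nea c) (dg y c)).
have d2 : denotes env y c' (neg (Op Mul (theta_cell sv) (Cell acc_addr)))
    (- (theta`_s * c')).
  apply: denotes_neg.
  exact: (denotes_op (denotes_theta y c' es svs sNe) (dacc y c')).
have d3 y1 : denotes env y1 c' (Op Add (Cell acc_addr)
    (Op Mul (far_expr sv ei) (g_cell si)))
    (c' + far_peak lambda`_s (mesh x edge.+1) * gs`_src).
  apply: (denotes_op (dacc y1 c')) => //.
  exact: (denotes_op (fa y1 c') (dg y1 c')).
have t1 := triple_set_acc es d1 isT.
have t2 := triple_add_out es did dN d2 isT.
have t3 := triple_set_acc es (d3 _) isT.
exact: (triple_seq t1 (triple_seq t2 (t3 _))).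
Qed.

(** Every loop over the grid adds to one output cell per iteration.  The total
    is kept as a sum over iterations, which extends by one term per step
    whatever the order a in which the cells are visited. *)
Definition scatter (n : nat) (a : nat -> nat) (d : nat -> R) (j : nat) : R :=
  \sum_(t < n) if j == a t then d t else 0.

Lemma triple_scatter b c0 env e n q y (acc : nat -> R) (a : nat -> nat)
    (d : nat -> R) :
  iexp_val env e = n ->
  (forall t y', (t < n)%N ->
     triple b c0 [eta env with 3%N |-> t] (holds y' (acc t)) q
       (holds (fun j => y' j + (if j == a t then d t else 0)) (acc t.+1))) ->
  triple b (n * c0) env (holds y (acc 0%N)) (For 3 e q)
    (holds (fun j => y j + scatter n a d j) (acc n)).
Proof.
move=> <- step.
have := @triple_for _ b c0 env
  (fun t => holds (fun j => y j + scatter t a d j) (acc t)) 3 e q.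
rewrite (_ : (fun j => y j + scatter 0 a d j) = y); last first.
  by apply/funext => j; rewrite /scatter big_ord0 addr0.
apply=> t te; have := step t (fun j => y j + scatter t a d j) te.
congr triple; congr holds; apply/funext => j.
by rewrite /scatter big_ord_recr addrA.
Qed.

Definition diag_coef (k : nat) : R :=
  (mesh x k.+1 `^ (- alpha) + mesh x k.+2 `^ (- alpha)) / (alpha * (1 - alpha)).

Definition offdiag_coef (k : nat) : R := - (mesh x k.+1 `^ (- alpha) / (1 - alpha)).

Lemma triple_tridiagonal env y c : sized env ->
  triple bound (N.-1 * 37 + ((N - 2) * 25 + (N - 2) * 25)) env
    (holds y c) tridiagonal
    (holds (fun j => y j + scatter N.-1 id (fun t => diag_coef t * gs`_t) j
                     + scatter (N - 2) id (fun t => offdiag_coef t.+1 * gs`_t.+1) j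
                     + scatter (N - 2) succn (fun t => offdiag_coef t.+1 * gs`_t) j)
           c).
Proof.
move=> es; have [e0 e1] := es.
have es' t : sized [eta env with 3%N |-> t] by [].
have n1 : iexp_val env (ISub (IVar 0) (ILit 1)) = N.-1 by rewrite /= e0 subn1.
have n2 : iexp_val env (ISub (IVar 0) (ILit 2)) = (N - 2)%N by rewrite /= e0.
have v0 t : iexp_val [eta env with 3%N |-> t] (IVar 3) = t by [].
have v1 t : iexp_val [eta env with 3%N |-> t] (succ_addr (IVar 3)) = t.+1.
  by rewrite /= addn1.
have main y0 : triple bound (N.-1 * 37) env (holds y0 c)
    (For 3 (ISub (IVar 0) (ILit 1))
      (add_out (IVar 3) (Op Mul (diag_expr (IVar 3)) (g_cell (IVar 3)))))
    (holds (fun j => y0 j + scatter N.-1 id (fun t => diag_coef t * gs`_t) j) c).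
  apply: (@triple_scatter _ _ _ _ _ _ _ (fun=> c)) => // t y' tN.
  apply: (triple_add_out (es' t) (v0 t) tN); rewrite //.
  apply: denotes_op; [|exact: (denotes_g _ _ (es' t) (v0 t))|by []].
  by apply: (denotes_diag _ _ (v0 t)); lia.
have upper y0 : triple bound ((N - 2) * 25) env (holds y0 c)
    (For 3 (ISub (IVar 0) (ILit 2))
      (add_out (IVar 3)
        (Op Mul (offdiag_expr (succ_addr (IVar 3))) (g_cell (succ_addr (IVar 3))))))
    (holds (fun j => y0 j +
       scatter (N - 2) id (fun t => offdiag_coef t.+1 * gs`_t.+1) j) c).
  apply: (@triple_scatter _ _ _ _ _ _ _ (fun=> c)) => // t y' tN.
  apply: (triple_add_out (es' t) (v0 t)); rewrite //; first by lia.
  apply: denotes_op; [| |by []].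
    by apply: (denotes_offdiag _ _ (v1 t)); lia.
  by apply: (denotes_g _ _ (es' t) (v1 t)); lia.
have lower y0 : triple bound ((N - 2) * 25) env (holds y0 c)
    (For 3 (ISub (IVar 0) (ILit 2))
      (add_out (succ_addr (IVar 3))
        (Op Mul (offdiag_expr (succ_addr (IVar 3))) (g_cell (IVar 3)))))
    (holds (fun j => y0 j +
       scatter (N - 2) succn (fun t => offdiag_coef t.+1 * gs`_t) j) c).
  apply: (@triple_scatter _ _ _ _ _ _ _ (fun=> c)) => // t y' tN.
  apply: (triple_add_out (es' t) (v1 t)); rewrite //; first by lia.
  apply: denotes_op; [| |by []].
    by apply: (denotes_offdiag _ _ (v1 t)); lia.
  by apply: (denotes_g _ _ (es' t) (v0 t)); lia.
exact: (triple_seq (main y) (triple_seq (upper _) (lower _))).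
Qed.

(** The integral of the whole hat of column j against the exponential decaying
    from the node of row i, when the support lies to the left of that node. *)
Definition from_left (l : R) (i j : nat) : R :=
  expR (- l * (x`_i.+1 - x`_j.+1)) * near_peak l (mesh x j.+1)
  + expR (- l * (x`_i.+1 - x`_j.+2)) * far_peak l (mesh x j.+2).

(** The same integral when the support lies to the right of the node. *)
Definition from_right (l : R) (i j : nat) : R :=
  expR (- l * (x`_j - x`_i.+1)) * far_peak l (mesh x j.+1)
  + expR (- l * (x`_j.+1 - x`_i.+1)) * near_peak l (mesh x j.+2).

(** The closed form of the accumulator of the forward sweep, and its invariant:
    every column already visited enters with its whole hat, including the half
    that the current row itself does not see. *)
Definition left_acc (l : R) (t : nat) : R :=
  \sum_(j < t) from_left l t j * gs`_j.

Definition right_acc (l : R) (r : nat) : R :=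
  \sum_(r.+1 <= j < N.-1) from_right l r j * gs`_j.

(** The part of the product in row t.+1 that comes from the columns to its left,
    for one exponential and up to the factor - theta. *)
Definition left_tail (l : R) (t : nat) : R := advance l t.+1 t t (left_acc l t).

(** The part of the product in row r that comes from the columns to its right,
    likewise. *)
Definition right_tail (l : R) (r : nat) : R :=
  advance l r.+1 r.+2 r.+1 (right_acc l r.+1).

(** Moving the point of evaluation one node to the right multiplies every
    integral by the decay over the interval crossed. *)
Lemma left_tailE l t :
  left_tail l t = \sum_(j < t) from_left l t.+1 j * gs`_j
    + expR (- l * (x`_t.+2 - x`_t.+1)) * near_peak l (mesh x t.+1) * gs`_t.
Proof.
rewrite /left_tail /advance mulrDr mulr_sumr mulrA mulNr; congr (_ + _).
apply: eq_bigr => j _; rewrite mulrA; congr (_ * _).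
rewrite /from_left [LHS]mulrDr; congr (_ + _).
  by rewrite [LHS]mulrA -expRD /mesh /=; congr (expR _ * _); ring.
by rewrite [LHS]mulrA -expRD /mesh /=; congr (expR _ * _); ring.
Qed.

Lemma left_acc_step l t :
  left_acc l t.+1 = left_tail l t + far_peak l (mesh x t.+2) * gs`_t.
Proof.
rewrite /left_acc big_ord_recr left_tailE /= -addrA -mulrDl.
by rewrite {2}/from_left subrr mulr0 expR0 mul1r.
Qed.

Lemma right_tailE l r : right_tail l r =
    expR (- l * (x`_r.+2 - x`_r.+1)) * near_peak l (mesh x r.+3) * gs`_r.+1
    + \sum_(r.+2 <= j < N.-1) from_right l r j * gs`_j.
Proof.
rewrite /right_tail /advance mulrDr mulr_sumr mulrA mulNr addrC; congr (_ + _).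
apply: eq_bigr => j _; rewrite mulrA; congr (_ * _).
rewrite /from_right [LHS]mulrDr; congr (_ + _).
  by rewrite [LHS]mulrA -expRD /mesh /=; congr (expR _ * _); ring.
by rewrite [LHS]mulrA -expRD /mesh /=; congr (expR _ * _); ring.
Qed.

Lemma right_acc_step l r : (r.+1 < N.-1)%N ->
  right_acc l r = right_tail l r + far_peak l (mesh x r.+2) * gs`_r.+1.
Proof.
move=> rN; rewrite /right_acc big_ltn // right_tailE addrAC -mulrDl.
by congr (_ * _ + _); rewrite /from_right subrr mulr0 expR0 mul1r addrC.
Qed.

Lemma triple_sweeps env y s c : sized env -> env 2%N = s -> (s < Ne)%N ->
  triple bound (3 + (N - 2) * 110 + (3 + (N - 2) * 110)) env
    (holds y c)
    (Seq (Seq (set_acc (Const 0)) (forward_sweep (IVar 2)))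
         (Seq (set_acc (Const 0)) (backward_sweep (IVar 2))))
    (holds (fun j => y j
       + scatter (N - 2) succn (fun t => - (theta`_s * left_tail lambda`_s t)) j
       + scatter (N - 2) (fun t => N - 3 - t)%N
           (fun t => - (theta`_s * right_tail lambda`_s (N - 3 - t))) j)
       (right_acc lambda`_s (N - 2 - (N - 2)))).
Proof.
move=> es env2 sNe; have [e0 e1] := es.
set l := lambda`_s.
have es' t : sized [eta env with 3%N |-> t] by [].
have n2 : iexp_val env (ISub (IVar 0) (ILit 2)) = (N - 2)%N by rewrite /= e0.
have sv t : iexp_val [eta env with 3%N |-> t] (IVar 2) = s by [].
have v0 t : iexp_val [eta env with 3%N |-> t] (IVar 3) = t by [].
have v1 t : iexp_val [eta env with 3%N |-> t] (succ_addr (IVar 3)) = t.+1.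
  by rewrite /= addn1.
pose r := ISub (IVar 0) (IAdd (ILit 3) (IVar 3)).
have r0 t : iexp_val [eta env with 3%N |-> t] r = (N - 3 - t)%N.
  by rewrite /= e0 subnDA.
have r1 t : iexp_val [eta env with 3%N |-> t] (succ_addr r) = (N - 3 - t).+1.
  by rewrite -r0 /= addn1.
have r2 t : iexp_val [eta env with 3%N |-> t] (succ_addr (succ_addr r)) = (N - 3 - t).+2.
  by rewrite -r0 /= !addn1.
have reset y0 c0 : triple bound 3 env (holds y0 c0) (set_acc (Const 0)) (holds y0 0).
  exact: (@triple_set_acc _ _ _ (Const 0) 0 es).
have fwd y0 : triple bound ((N - 2) * 110) env (holds y0 0)
    (forward_sweep (IVar 2))
    (holds (fun j => y0 j +
       scatter (N - 2) succn (fun t => - (theta`_s * left_tail l t)) j)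
       (left_acc l (N - 2))).
  have left0 : left_acc l 0 = 0 by rewrite /left_acc big_ord0.
  rewrite -{1}left0.
  apply: (@triple_scatter _ _ _ _ _ _ _ (left_acc l)) => // t y' tN.
  rewrite left_acc_step.
  by apply: (triple_sweep_step _ _ (es' t) (sv t) sNe (v1 t) _ (v0 t) _ (v0 t) _ (v1 t));
    lia.
have bwd y0 : triple bound ((N - 2) * 110) env (holds y0 0)
    (backward_sweep (IVar 2))
    (holds (fun j => y0 j +
       scatter (N - 2) (fun t => N - 3 - t)%N
           (fun t => - (theta`_s * right_tail l (N - 3 - t))) j)
       (right_acc l (N - 2 - (N - 2)))).
  have right0 : right_acc l (N - 2 - 0) = 0 by rewrite /right_acc big_geq //; lia.
  rewrite -{1}right0.
  (* Before iteration t the accumulator belongs to row N - 2 - t; initially this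
     is the last row, which has no columns to its right. *)
  apply: (@triple_scatter _ _ _ _ _ _ _ (fun t => right_acc l (N - 2 - t))) => //.
  move=> t y' tN.
  have -> : (N - 2 - t.+1 = N - 3 - t)%N by lia.
  rewrite (@right_acc_step _ (N - 3 - t)); last by lia.
  have -> : (N - 2 - t = (N - 3 - t).+1)%N by lia.
  by apply: (triple_sweep_step _ _ (es' t) (sv t) sNe (r1 t) _ (r2 t) _ (r1 t) _ (r0 t));
    lia.
exact: (triple_seq (triple_seq (reset _ _) (fwd _))
  (triple_seq (reset _ _) (bwd _))).
Qed.

(** * The program computes the product *)

Lemma scatter_hit n a d t :
  (t < n)%N -> (forall u, (u < n)%N -> a u = a t -> u = t) ->
  scatter n a d (a t) = d t.
Proof.
move=> tn inj; rewrite /scatter (bigD1 (Ordinal tn)) //= eqxx big1 ?addr0 //.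
move=> u ut; rewrite ifF //; apply: contra_neqF ut => /eqP au.
by apply/val_inj/inj; rewrite //= au.
Qed.

Lemma scatter_miss n a d j :
  (forall u, (u < n)%N -> a u != j) -> scatter n a d j = 0.
Proof.
by move=> miss; apply: big1 => u _; rewrite eq_sym ifN // miss.
Qed.

Definition tridiagonal_part (i : nat) : R :=
  scatter N.-1 id (fun t => diag_coef t * gs`_t) i
  + scatter (N - 2) id (fun t => offdiag_coef t.+1 * gs`_t.+1) i
  + scatter (N - 2) succn (fun t => offdiag_coef t.+1 * gs`_t) i.

Definition exponential_part (s i : nat) : R :=
  scatter (N - 2) succn (fun t => - (theta`_s * left_tail lambda`_s t)) i
  + scatter (N - 2) (fun t => N - 3 - t)%N
      (fun t => - (theta`_s * right_tail lambda`_s (N - 3 - t))) i.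

Lemma triple_fast_matvec :
  triple bound (N.-1 * 37 + ((N - 2) * 25 + (N - 2) * 25)
      + Ne * (3 + (N - 2) * 110 + (3 + (N - 2) * 110))) (size_env N Ne)
    (holds (fun=> 0) 0) fast_matvec
    (fun m => exists c, holds
       (fun i => tridiagonal_part i + \sum_(s < Ne) exponential_part s i) c m).
Proof.
have es : sized (size_env N Ne) by [].
apply: triple_seq (triple_tridiagonal (fun=> 0) 0 es) _.
pose P s m := exists c,
  holds (fun i => tridiagonal_part i + \sum_(u < s) exponential_part u i) c m.
have loop := @triple_for _ bound (3 + (N - 2) * 110 + (3 + (N - 2) * 110))
  (size_env N Ne) P 2 (IVar 1)
  (Seq (Seq (set_acc (Const 0)) (forward_sweep (IVar 2)))
       (Seq (set_acc (Const 0)) (backward_sweep (IVar 2)))).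
have step s (sNe : (s < Ne)%N) c := @triple_sweeps
    [eta size_env N Ne with 2%N |-> s]
    (fun i => tridiagonal_part i + \sum_(u < s) exponential_part u i) s c
    es erefl sNe.
case: loop => [s sNe|l1 l2 l3].
  have [c1 c2 _] := step s sNe 0; split=> // m [c hm].
  have [_ _ /(_ m hm) [m' run' hm']] := step s sNe c.
  exists m' => //; eexists; move: hm'; congr holds; apply/funext => i.
  by rewrite big_ord_recr /= /exponential_part !addrA.
split=> // m hm; apply: l3; exists 0; move: hm; congr (holds _ _ _).
by apply/funext => i; rewrite big_ord0 /tridiagonal_part add0r addr0.
Qed.

(** The exponential part of the entry (i, j) below the diagonal.  On the first
    subdiagonal the half hat next to the node x_(i+1) belongs to the
    tridiagonal part, so only the other half is approximated. *)
Definition kernel_left (l : R) (i j : nat) : R :=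
  if (j.+1 < i)%N then from_left l i j
  else if i == j.+1 then
    expR (- l * (x`_i.+1 - x`_j.+1)) * near_peak l (mesh x j.+1)
  else 0.

Definition kernel_right (l : R) (i j : nat) : R :=
  if (i.+1 < j)%N then from_right l i j
  else if j == i.+1 then
    expR (- l * (x`_j.+1 - x`_i.+1)) * near_peak l (mesh x j.+2)
  else 0.

Lemma coefE i j : (i < N.-1)%N -> (j < N.-1)%N ->
  coef alpha x lambda theta i.+1 j.+1 =
    (if j == i then diag_coef i else 0) + (if j == i.+1 then offdiag_coef j else 0)
    + (if i == j.+1 then offdiag_coef i else 0)
    - \sum_(s < Ne) theta`_s *
        (kernel_left lambda`_s i j + kernel_right lambda`_s i j).
Proof.
move=> iN jN; rewrite /coef !eqSS.
have swap F : (forall s : 'I_Ne,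
      F s = kernel_left lambda`_s i j + kernel_right lambda`_s i j) ->
    \sum_(s < Ne) tnth theta s * F s = \sum_(s < Ne) theta`_s *
        (kernel_left lambda`_s i j + kernel_right lambda`_s i j).
  by move=> FE; apply: eq_bigr => s _; rewrite (tnth_nth 0) FE.
case: ifP => [ij|ij2].
  rewrite !ifF; try lia.
  rewrite !addr0 sub0r integral_hat_soe //; last by lia.
  congr (- _); apply: swap => s; rewrite (tnth_nth 0).
  have [ji ij'] : (j.+1 < i)%N = false /\ (i == j.+1) = false by lia.
  rewrite /kernel_left /kernel_right -[(i.+1 < j)%N]/(i.+2 < j.+1)%N.
  by rewrite ij ji ij' add0r.
case: ifP => [/eqP ji|ji].
  subst j.
  rewrite !ifF; try lia.
  rewrite add0r addr0 integral_falling_soe //; last by lia.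
  congr (_ - _); apply: swap => s; rewrite (tnth_nth 0).
  rewrite /kernel_left /kernel_right !ltnn eqxx !ifF; try lia.
  by rewrite add0r.
case: ifP => [/eqP ->|ij].
  rewrite !ifF; try lia.
  rewrite !addr0 big1 ?subr0 // => s _.
  rewrite /kernel_left /kernel_right !ifF; try lia.
  by rewrite addr0 mulr0.
case: ifP => [/eqP ij'|ij'].
  subst i; rewrite eqxx.
  rewrite !add0r subn2 /= integral_rising_soeN //; last by lia.
  congr (_ - _); apply: swap => s; rewrite (tnth_nth 0).
  rewrite /kernel_left /kernel_right ltnn eqxx !ifF; try lia.
  by rewrite addr0.
rewrite !ifF; try lia.
rewrite !add0r integral_hat_soeN //; last by lia.
congr (- _); apply: swap => s; rewrite (tnth_nth 0).
rewrite /kernel_left /kernel_right ifT; last by lia.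
rewrite !ifF; try lia.
by rewrite addr0.
Qed.

Lemma sum_kernel_left l i : (i < N.-1)%N ->
  \sum_(0 <= j < N.-1) kernel_left l i j * gs`_j =
  if i is t.+1 then left_tail l t else 0.
Proof.
move=> iN; rewrite (@big_cat_nat _ _ _ i) //=; last exact: ltnW.
rewrite [X in _ + X]big_nat_cond [X in _ + X]big1 ?addr0; last first.
  by move=> j /andP[/andP[ij jN] _]; rewrite /kernel_left !ifF ?mul0r //; lia.
case: i iN => [|t] tN; first by rewrite big_nil.
rewrite big_nat_recr //= left_tailE big_mkord; congr (_ + _).
  by apply: eq_bigr => j _; rewrite /kernel_left ifT // ltnS.
by rewrite /kernel_left ltnn eqxx.
Qed.

Lemma sum_kernel_right l i : (i < N.-1)%N ->
  \sum_(0 <= j < N.-1) kernel_right l i j * gs`_j =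
  if (i < N - 2)%N then right_tail l i else 0.
Proof.
move=> iN; rewrite (@big_cat_nat _ _ _ i.+1) //=.
rewrite big_nat_cond big1 ?add0r; last first.
  by move=> j /andP[/andP[ij jN] _]; rewrite /kernel_right !ifF ?mul0r //; lia.
case: ltnP => iN2; last by rewrite big_geq //; lia.
rewrite big_ltn; last by lia.
rewrite right_tailE; congr (_ + _).
  by rewrite /kernel_right ltnn eqxx.
by apply: eq_big_nat => j /andP[ij _]; rewrite /kernel_right ifT.
Qed.

Lemma exponential_partE s i : (i < N.-1)%N ->
  exponential_part s i = - (theta`_s * \sum_(0 <= j < N.-1)
    (kernel_left lambda`_s i j + kernel_right lambda`_s i j) * gs`_j).
Proof.
move=> iN; under eq_bigr do rewrite mulrDl.
rewrite big_split /= sum_kernel_left // sum_kernel_right // mulrDr opprD.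
congr (_ + _).
  case: i iN => [|t] tN; first by rewrite scatter_miss // mulr0 oppr0.
  by rewrite (@scatter_hit _ succn) //; [lia | move=> u _ []].
case: ltnP => iN2; last first.
  by rewrite scatter_miss ?mulr0 ?oppr0 // => u un; lia.
have -> : i = (N - 3 - (N - 3 - i))%N by lia.
rewrite (@scatter_hit _ (fun t => N - 3 - t)%N) //; first by lia.
by move=> u un; lia.
Qed.

Lemma tridiagonal_partE i : (i < N.-1)%N ->
  tridiagonal_part i = \sum_(0 <= j < N.-1)
    ((if j == i then diag_coef i else 0) + (if j == i.+1 then offdiag_coef j else 0)
    + (if i == j.+1 then offdiag_coef i else 0)) * gs`_j.
Proof.
move=> iN; under eq_bigr do rewrite !mulrDl.
rewrite !big_split /= /tridiagonal_part; congr (_ + _ + _).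
- rewrite big_mkord; apply: eq_bigr => j _; rewrite eq_sym.
  by case: eqP => [->//|_]; rewrite mul0r.
(* Column 0 has no entry above the diagonal, and the last column none below. *)
- have -> : index_iota 0 N.-1 = index_iota 0 (N - 2).+1 by congr index_iota; lia.
  rewrite big_nat_recl //= mul0r add0r /scatter big_mkord.
  apply: eq_bigr => j _; rewrite eqSS eq_sym.
  by case: eqP => [->//|_]; rewrite mul0r.
- have -> : index_iota 0 N.-1 = index_iota 0 (N - 2).+1 by congr index_iota; lia.
  rewrite big_nat_recr //= [X in _ + X * _]ifF; last by lia.
  rewrite mul0r addr0 /scatter big_mkord; apply: eq_bigr => j _.
  by case: eqP => [->//|_]; rewrite mul0r.
Qed.

Lemma nth_g (i : 'I_N.-1) : gs`_i = g i 0.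
Proof. by rewrite (nth_map i) ?size_enum_ord ?nth_ord_enum. Qed.

Lemma matvecE (i : 'I_N.-1) :
  (coef_mx alpha x lambda theta *m g) i 0 =
  tridiagonal_part i + \sum_(s < Ne) exponential_part s i.
Proof.
have iN := ltn_ord i.
rewrite mxE tridiagonal_partE // big_mkord.
under [X in _ = _ + X]eq_bigr do
  rewrite exponential_partE // big_mkord mulr_sumr.
rewrite sumrN.
rewrite exchange_big -sumrB; apply: eq_bigr => j _ /=.
rewrite mxE coefE // mulrBl nth_g; congr (_ - _).
by rewrite mulr_suml; apply: eq_bigr => s _; rewrite mulrA.
Qed.

Lemma fast_matvec_outputs :
  outputs Ne fast_matvec (input alpha x lambda theta g)
    (coef_mx alpha x lambda theta *m g).
Proof.
have [_ _ run_ok] := triple_fast_matvec.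
have init : holds (fun=> 0) 0 (nth 0 inp).
  split=> [//|i iN|]; rewrite nth_default // size_input; lia.
have [m run_m [c [_ out_m _]]] := run_ok _ init.
by exists m => // i; rewrite out_m // matvecE.
Qed.

Lemma op_count_fast_matvec : (0 < N)%N -> (0 < Ne)%N ->
  (op_count fast_matvec (size_env N Ne) <= 320 * (N * Ne))%N.
Proof.
move=> N0 Ne0; have [ops _ _] := triple_fast_matvec.
have h1 : (N <= N * Ne)%N by rewrite leq_pmulr.
have h2 : (Ne <= N * Ne)%N by rewrite leq_pmull.
have h3 : (Ne * (N - 2) <= N * Ne)%N by rewrite mulnC leq_mul2r leq_subr orbT.
by nia.
Qed.

Lemma memory_count_fast_matvec : (0 < N)%N -> (0 < Ne)%N ->
  (memory_count N Ne fast_matvec <= 320 * (N * Ne))%N.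
Proof.
move=> N0 Ne0; have [_ cells _] := triple_fast_matvec.
have h1 : (N <= N * Ne)%N by rewrite leq_pmulr.
have h2 : (Ne <= N * Ne)%N by rewrite leq_pmull.
rewrite /memory_count geq_max; apply/andP; split.
  by rewrite /input_size; lia.
apply: leq_trans cells _; rewrite /input_size; lia.
Qed.

End FastMatvec.

Theorem theorem2p5 (R : realType) :
  exists (p : program) (C : nat),
    forall (N Ne : nat) (alpha : R) (x : N.+1.-tuple R)
      (lambda theta : Ne.-tuple R),
    (0 < N)%N -> (0 < Ne)%N -> 0 < alpha < 1 ->
    (forall k : nat, (k < N)%N -> x`_k < x`_k.+1) ->
    (forall s : 'I_Ne, 0 < tnth lambda s) ->
    (forall s : 'I_Ne, 0 < tnth theta s) ->
    [/\ forall g : 'cV[R]_N.-1,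
          outputs Ne p (input alpha x lambda theta g)
            (coef_mx alpha x lambda theta *m g),
        (op_count p (size_env N Ne) <= C * (N * Ne))%N
      & (memory_count N Ne p <= C * (N * Ne))%N].
Proof.
(* 37 operations per diagonal entry, 25 per off-diagonal one, and for each
   exponential 2 * 110 per grid point and 2 * 3 to reset the accumulator. *)
exists fast_matvec, 320%N => N Ne alpha x lambda theta N0 Ne0 a01 x_lt l0 _.
split=> [g||].
- exact: fast_matvec_outputs.
- exact: (op_count_fast_matvec theta (0 : 'cV_N.-1) a01 x_lt l0).
- exact: (memory_count_fast_matvec theta (0 : 'cV_N.-1) a01 x_lt l0).
Qed.
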